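(* None of the three logical omniscience principles for ignorance is valid in $\mathtt{HIW}$, $\mathtt{HIU}$ or $\mathtt{HDI}$. That is, for each operator $I\in\{I^{w},I^{u},I^{d}\}$, with formulas ranging over the corresponding language and $\models\phi$ meaning that $\phi$ is valid in all topic-sensitive models: (1) there are formulas $\phi,\psi$ such that $\models\phi\rightarrow\psi$ but $\not\models\neg I\phi\rightarrow\neg I\psi$; (2) there is a formula $\phi$ such that $\models\phi$ but $\not\models\neg I\phi$; (3) there are formulas $\phi,\psi$ such that $\models\phi\leftrightarrow\psi$ but $\not\models\neg I\phi\leftrightarrow\neg I\psi$.
   Context: Let $\mathtt{Prop}$ be a countably infinite set of propositional variables. The languages are: for $\mathtt{HIW}$, $\phi:=p\mid\neg\phi\mid\phi\wedge\phi\mid I^{w}\phi\mid\Box\phi$; for $\mathtt{HIU}$, the same with $I^{u}$ in place of $I^{w}$; for $\mathtt{HDI}$, $\phi:=p\mid\neg\phi\mid\phi\wedge\phi\mid I^{d}\phi\mid G\phi\mid\Box\phi$. $\vee,\rightarrow,\leftrightarrow$ are defined classically. $Var(\phi)$ is the set of variables occurring in $\phi$. A topic model is $\mathcal{T}=(T,\oplus,t,\mathfrak{K})$ with $T$ a non-empty set, $\oplus:T\times T\to T$ idempotent, commutative and associative, $\mathfrak{K}\in T$, and $t:\mathtt{Prop}\to T$. Extend $t$ to formulas by $t(\phi)=\oplus\{t(p):p\in Var(\phi)\}$, and put $a\sqsubseteq b$ iff $a\oplus b=b$. A topic-sensitive model is $\mathcal{M}=(W,R,v,\mathcal{T})$ with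 $W\neq\emptyset$, $R\subseteq W\times W$ arbitrary, $v:\mathtt{Prop}\to\mathcal{P}(W)$, and $\mathcal{T}$ a topic model. Truth: $\mathcal{M},w\models p$ iff $w\in v(p)$; $\neg,\wedge$ classical; $\mathcal{M},w\models\Box\phi$ iff $\mathcal{M},w'\models\phi$ for all $w'\in W$; and - $\mathcal{M},w\models I^{w}\phi$ iff $t(\phi)\not\sqsubseteq\mathfrak{K}$ or there exist $w',w''\in W$ with $Rww'$, $Rww''$, $\mathcal{M},w'\models\phi$ and $\mathcal{M},w''\models\neg\phi$; - $\mathcal{M},w\models I^{u}\phi$ iff $t(\phi)\not\sqsubseteq\mathfrak{K}$ or ($\mathcal{M},w\models\phi$ and there exists $w'\in W$ with $Rww'$ and $\mathcal{M},w'\models\neg\phi$); - $\mathcal{M},w\models I^{d}\phi$ iff $t(\phi)\sqsubseteq\mathfrak{K}$ and $\mathcal{M},w\models\phi$ and for all $w'\neq w$, if $Rww'$ then $\mathcal{M},w'\models\neg\phi$; - $\mathcal{M},w\models G\phi$ iff $t(\phi)\sqsubseteq\mathfrak{K}$. A formula is valid ($\models\phi$) if it is true at every world of every topic-sensitive model. *)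

(* Defs.v *)
From mathcomp Require Import all_boot.

Set Implicit Arguments.
Unset Strict Implicit.
Unset Printing Implicit Defensive.

Inductive logic := HIW | HIU | HDI.

(* [form P L] is the language of [L] over the propositional variables [P];
   [Ign] is I^w, I^u or I^d according to [L], and [Grasp] is the operator G,
   available in HDI only. *)
Inductive form (P : Type) : logic -> Type :=
| Var L of P : form P L
| Neg L of form P L : form P L
| And L of form P L & form P L : form P L
| Ign L of form P L : form P L
| Grasp of form P HDI : form P HDI
| Box L of form P L : form P L.

Arguments Var {P L} _.

Definition Or P L (phi psi : form P L) := Neg (And (Neg phi) (Neg psi)).
Definition Imp P L (phi psi : form P L) := Or (Neg phi) psi.
Definition Iff P L (phi psi : form P L) := And (Imp phi psi) (Imp psi phi).

(* Var(phi), which is never empty, listed as a head and a tail, possibly with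
   repetitions. *)
Fixpoint vars P L (phi : form P L) : P * seq P :=
  match phi with
  | Var _ p => (p, [::])
  | Neg _ phi => vars phi
  | And _ phi psi =>
      ((vars phi).1, (vars phi).2 ++ (vars psi).1 :: (vars psi).2)
  | Ign _ phi => vars phi
  | Grasp phi => vars phi
  | Box _ phi => vars phi
  end.

(* Nonemptiness of [topic] is witnessed by [known]. *)
Record topic_model (P : Type) := TopicModel {
  topic : Type;
  fusion : topic -> topic -> topic;
  fusionxx : idempotent_op fusion;
  fusionC : commutative fusion;
  fusionA : associative fusion;
  topic_of : P -> topic;
  known : topic
}.

Definition topic_le P (T : topic_model P) (a b : topic T) : Prop :=
  fusion a b = b.

(* The order and the repetitions in [vars phi] are irrelevant because [fusion]
   is associative, commutative and idempotent. *)
Definition topic_form P (T : topic_model P) L (phi : form P L) : topic T :=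
  foldl (fun a p => fusion a (topic_of T p))
    (topic_of T (vars phi).1) (vars phi).2.

Record model (P : Type) := Model {
  world : Type;
  world_inhabited : inhabited world;
  rel_of : world -> world -> Prop;
  val_of : P -> world -> Prop;
  topics : topic_model P
}.

Definition grasped P (M : model P) L (phi : form P L) : Prop :=
  topic_le (topic_form (topics M) phi) (known (topics M)).

Fixpoint sat P (M : model P) L (phi : form P L) (w : world M) : Prop :=
  match phi with
  | Var _ p => val_of p w
  | Neg _ phi => ~ sat phi w
  | And _ phi psi => sat phi w /\ sat psi w
  | Ign L phi =>
      match L with
      | HIW => ~ grasped M phi \/
          (exists w' w'' : world M, [/\ rel_of w w', rel_of w w'', sat phi w'
                            & ~ sat phi w''])
      | HIU => ~ grasped M phi \/
          (sat phi w /\ exists w' : world M, rel_of w w' /\ ~ sat phi w')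
      | HDI => [/\ grasped M phi, sat phi w
          & forall w' : world M, w' <> w -> rel_of w w' -> ~ sat phi w']
      end
  | Grasp phi => grasped M phi
  | Box _ phi => forall w' : world M, sat phi w'
  end.

Definition valid P L (phi : form P L) : Prop :=
  forall (M : model P) (w : world M), sat phi w.

(* Main.v *)
Require Import Defs.
From mathcomp Require Import all_boot.

Set Implicit Arguments.
Unset Strict Implicit.
Unset Printing Implicit Defensive.

(** Two tautologies about different variables are equivalent, but one can be
    grasped while the other is not. At a world without successors, ignorance of
    a tautology is thus decided by its topic alone: I^w and I^u hold exactly
    when the topic is not grasped, I^d exactly when it is. All three principles
    fail at the same one-world model. *)

Definition taut (P : Type) (L : logic) (x : P) : form P L :=
  Or (Var x) (Neg (Var x)).

Lemma taut_valid (P : Type) (L : logic) (x : P) : valid (taut L x).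
Proof. by move=> M w /= [nx nnx]; exact: nnx. Qed.

Lemma valid_Imp (P : Type) (L : logic) (phi psi : form P L) :
  valid psi -> valid (Imp phi psi).
Proof. by move=> vpsi M w /= [_ npsi]; exact: npsi. Qed.

(** As [known] is [false], the bottom element for disjunction, [false] is the only topic below it: a
    formula is grasped iff none of its variables is marked by [ungrasped]. *)
Definition two_topics (P : Type) (ungrasped : P -> bool) : topic_model P :=
  TopicModel orbb orbC orbA ungrasped false.

Definition point_model (P : Type) (ungrasped : P -> bool) : model P :=
  Model (inhabits tt) (fun _ _ => False) (fun _ _ => True)
    (two_topics ungrasped).

Lemma grasped_taut (P : Type) (ungrasped : P -> bool) (L : logic) (x : P) :
  grasped (point_model ungrasped) (taut L x) <-> ungrasped x = false.
Proof. by rewrite /grasped /topic_le /topic_form /= orbb orbF. Qed.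

(** Lack of grasp suffices for I^w and I^u but excludes I^d; this boolean records the polarity, so
    that one argument covers all three logics. *)
Definition ignorance_needs_grasp (L : logic) : bool :=
  if L is HDI then true else false.

(** Since [rel_of] is empty, the second disjunct of I^w and I^u is unsatisfiable and the successor
    clause of I^d is vacuous, leaving only the condition on grasp. *)
Lemma sat_Ign_taut (P : Type) (ungrasped : P -> bool) (L : logic) (x : P) :
  @sat P (point_model ungrasped) L (Ign (taut L x)) tt <->
  ungrasped x = ~~ ignorance_needs_grasp L.
Proof.
have gP := grasped_taut ungrasped L x.
case: L gP => gP; split.
- case=> [ngr|[w' [w'' [[]]]]].
  by case: (ungrasped x) gP => // gP; case: ngr; apply/gP.
- by move=> ux; left=> /gP; rewrite ux.
- case=> [ngr|[_ [w' [[]]]]].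
  by case: (ungrasped x) gP => // gP; case: ngr; apply/gP.
- by move=> ux; left=> /gP; rewrite ux.
- by case=> /gP.
- by move=> ux; split; [exact/gP | exact: taut_valid | move=> w' _ []].
Qed.

Theorem proposition5 (P : Type) (P_countably_infinite : exists e : nat -> P, bijective e)
    (L : logic) :
  (exists phi psi : form P L,
      valid (Imp phi psi) /\ ~ valid (Imp (Neg (Ign phi)) (Neg (Ign psi))))
  /\ (exists phi : form P L,
      valid phi /\ ~ valid (Neg (Ign phi)))
  /\ (exists phi psi : form P L,
      valid (Iff phi psi) /\ ~ valid (Iff (Neg (Ign phi)) (Neg (Ign psi)))).
Proof.
case: P_countably_infinite => e [f ef _].
pose M := point_model (fun x => f x == 1).
(* Booleans are read as the indices 0 and 1, and [e 1] is the ungrasped variable. So [psi] is about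
   [e 1] for [HIW] and [HIU], about [e 0] for [HDI], and [phi] is about the other one: in each logic
   [psi] is ignored and [phi] is not. *)
pose phi := taut L (e (ignorance_needs_grasp L)).
pose psi := taut L (e (~~ ignorance_needs_grasp L)).
have vphi : valid phi by exact: taut_valid.
have vpsi : valid psi by exact: taut_valid.
have nIphi : ~ @sat P M L (Ign phi) tt.
  by move/sat_Ign_taut; rewrite ef; case: (ignorance_needs_grasp L).
have Ipsi : @sat P M L (Ign psi) tt.
  by apply/sat_Ign_taut; rewrite ef; case: (ignorance_needs_grasp L).
(* [Imp] unfolds to negations and a conjunction, so refuting it takes only double negations of known
   facts, without excluded middle. *)
have nImp : ~ @sat P M L (Imp (Neg (Ign phi)) (Neg (Ign psi))) tt.
  by apply; split; [apply; exact: nIphi | apply; exact: Ipsi].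
split; [|split].
- exists phi, psi; split; first exact: valid_Imp.
  by move=> /(_ M tt).
- by exists psi; split=> // /(_ M tt); apply.
(* The left conjunct of [Iff] is the implication refuted by [nImp]. *)
- exists phi, psi; split; last by move=> /(_ M tt) [].
  by move=> M' w; split; exact: valid_Imp.
Qed.
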